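(* Let $A\in\mathbb{R}^{m\times n}$, let $k$ be a positive integer, and let $0<q\le 1$ and $p>0$ be fixed. If every $k$-sparse vector $x\in\mathbb{R}^n$ can be recovered by $l_{h_{p,q}}$-minimization, then $$\|x_S\|_{h_{p,q}}<\|x_{S^c}\|_{h_{p,q}}$$ for any non-zero vector $x\in N(A)$ and any index set $S\subseteq\{1,\dots,n\}$ with $|S|\le k$.
   Context: For $p>0$ and $0<q\le 1$ let $h_{p,q}(t)=\log\left(1+|t|^q/p\right)$ for $t\in\mathbb{R}$, and for $x\in\mathbb{R}^n$ let $\|x\|_{h_{p,q}}=\sum_{i=1}^n h_{p,q}(x_i)$. A vector $x$ is $k$-sparse if it has at most $k$ non-zero entries. $N(A)=\{x\in\mathbb{R}^n: Ax=0\}$. For an index set $S$, $x_S\in\mathbb{R}^n$ equals $x$ on $S$ and is zero elsewhere, and $S^c$ is the complement of $S$ in $\{1,\dots,n\}$. A vector $x$ ''can be recovered by $l_{h_{p,q}}$-minimization'' means that $x$ is the unique solution of $\min_{z\in\mathbb{R}^n}\|z\|_{h_{p,q}}$ subject to $Az=Ax$. *)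

(* Defs.v *)
From mathcomp Require Import all_boot all_order all_algebra.
From mathcomp Require Import reals exp.

Set Implicit Arguments.
Unset Strict Implicit.
Unset Printing Implicit Defensive.

Import Order.TTheory GRing.Theory Num.Theory.

Local Open Scope ring_scope.

(* For q > 0 the library's real power satisfies 0 `^ q = 0, so h p q 0 = 0. *)
Definition h {R : realType} (p q t : R) : R := ln (1 + `|t| `^ q / p).

Definition hnorm {R : realType} (p q : R) (n : nat) (x : 'cV[R]_n) : R :=
  \sum_(i < n) h p q (x i ord0).

Definition sparse {R : realType} (k n : nat) (x : 'cV[R]_n) : Prop :=
  (#|[set i : 'I_n | x i ord0 != 0%R]| <= k)%N.

Definition restrict {R : realType} (n : nat) (S : {set 'I_n}) (x : 'cV[R]_n) :
    'cV[R]_n :=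
  \col_i (if i \in S then x i ord0 else 0).

Definition h_solution {R : realType} (p q : R) (m n : nat) (A : 'M[R]_(m, n))
    (b : 'cV[R]_m) (z : 'cV[R]_n) : Prop :=
  A *m z = b /\
  forall w : 'cV[R]_n, A *m w = b -> hnorm p q z <= hnorm p q w.

Definition recoverable {R : realType} (p q : R) (m n : nat)
    (A : 'M[R]_(m, n)) (x : 'cV[R]_n) : Prop :=
  h_solution p q A (A *m x) x /\
  forall z : 'cV[R]_n, h_solution p q A (A *m x) z -> z = x.

(* Main.v *)
Require Import Defs.
From mathcomp Require Import all_boot all_order all_algebra.
From mathcomp Require Import reals exp.

Import Order.TTheory GRing.Theory Num.Theory.

Local Open Scope ring_scope.

(** A kernel vector splits as [x = x_S + x_{S^c}], so [x_S] and [- x_{S^c}] have the same image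
    under [A]. As [x_S] is k-sparse, it is the unique minimizer for that image. Were the strict
    inequality false, [- x_{S^c}], whose norm is that of [x_{S^c}], would be a minimizer too, hence
    equal to [x_S], which forces [x = 0]. *)

Lemma restrict_setC_add (R : realType) (n : nat) (S : {set 'I_n})
    (x : 'cV[R]_n) : restrict S x + restrict (~: S) x = x.
Proof.
by apply/colP => i; rewrite !mxE in_setC; case: (i \in S); rewrite ?addr0 ?add0r.
Qed.

Lemma hnormN (R : realType) (p q : R) (n : nat) (x : 'cV[R]_n) :
  hnorm p q (- x) = hnorm p q x.
Proof. by apply: eq_bigr => i _; rewrite /h mxE normrN. Qed.

Lemma sparse_restrict (R : realType) (k n : nat) (S : {set 'I_n})
    (x : 'cV[R]_n) : (#|S| <= k)%N -> sparse k (restrict S x).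
Proof.
apply: leq_trans; apply/subset_leq_card/subsetP => i.
by rewrite inE mxE; case: (i \in S); rewrite ?eqxx.
Qed.

(** Turns the coincidence of the two minimizers into a contradiction with [x != 0]: the two parts of
    [x] then cancel in their sum. *)
Lemma restrict_eqN_setC (R : realType) (n : nat) (S : {set 'I_n})
    (x : 'cV[R]_n) : - restrict (~: S) x = restrict S x -> x = 0.
Proof. by move=> e; rewrite -(restrict_setC_add _ _ S x) -e addNr. Qed.

Theorem theorem2 (R : realType) (m n : nat) (A : 'M[R]_(m, n)) (k : nat)
    (p q : R) (hk : (0 < k)%N) (hq0 : 0 < q) (hq1 : q <= 1) (hp : 0 < p)
    (hrec : forall x : 'cV[R]_n, sparse k x -> recoverable p q A x) :
  forall x : 'cV[R]_n, x != 0 -> A *m x = 0 ->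
  forall S : {set 'I_n}, (#|S| <= k)%N ->
    hnorm p q (restrict S x) < hnorm p q (restrict (~: S) x).
Proof.
move=> x /eqP x0 Ax0 S Sk.
have [[_ xS_min] xS_uniq] := hrec _ (sparse_restrict _ _ _ _ x Sk).
(* [- x_{S^c}] is feasible for [x_S] because [x] is in the kernel of [A]. *)
have feas : A *m - restrict (~: S) x = A *m restrict S x.
  apply/esym/eqP; rewrite mulmxN -subr_eq0 opprK -mulmxDr.
  by rewrite restrict_setC_add Ax0.
rewrite ltNge; apply/negP => le_norm.
apply: x0; apply: (restrict_eqN_setC _ _ S).
(* By [le_norm], [- x_{S^c}] costs at most as much as the minimizer [x_S], hence at most as much as
   any feasible [w]. *)
apply: xS_uniq; split=> // w /xS_min; apply: le_trans.
by rewrite hnormN.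
Qed.
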